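(* Let $\psi\in\mathcal C$, let $F_1,F_2:\mathbb R\to(0,\infty)$ be measurable and let $h\in\Phi\cup\Psi$. Then for every $T\in SL_{\pm}(n)$, $$as^{orlicz}_{h,F_1,F_2}(\psi\circ T)=as^{orlicz}_{h,F_1,F_2}(\psi)\quad\text{and}\quad G^{orlicz}_{h,F_1,F_2}(\psi\circ T)=G^{orlicz}_{h,F_1,F_2}(\psi).$$ In particular, for $f=e^{-\psi}$, $as^{orlicz}_h(f)$ and $G^{orlicz}_h(f)$ are $SL_{\pm}(n)$-invariant.
   Context: $\mathcal C$ is the set of convex functions $\psi:\mathbb R^n\to\mathbb R\cup\{+\infty\}$ whose domain has nonempty interior; $\psi^*(y)=\sup_x(\langle x,y\rangle-\psi(x))$; $\nabla^2\psi$ is the Alexandrov Hessian; $X_\psi=\{x:\psi(x)<\infty,\ \nabla^2\psi(x)\text{ exists and is invertible}\}$. $I(g,\psi^* )=\int_{X_{\psi^*}}g$; $\mathcal F^+_{\psi^*}$ is the set of integrable $g>0$ on $X_{\psi^*}$ with $0<I(g,\psi^* )<\infty$; $\mathcal L_{\psi^*}$ is the subset of log-concave members of $\mathcal F^+_{\psi^*}$. For continuous $h:(0,\infty)\to(0,\infty)$, $V_{h,F_1,F_2}(\psi,g)=\int_{X_\psi}h\big(\frac{g(\nabla\psi(x))}{F_2(\langle x,\nabla\psi(x)\rangle-\psi(x))}\big)F_1(\psi(x))dx$. $\Phi$ is the set of $h$ that are constant or strictly convex; $\Psi$ is the set of $h$ that are constant or increasing and strictly concave. For $h\in\Phi$: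 $$as^{orlicz}_{h,F_1,F_2}(\psi)=\inf_{g\in\mathcal F^+_{\psi^*}}V_{h,F_1,F_2}\Big(\psi,\tfrac{(\sqrt{2\pi})^n g}{I(g,\psi^* )}\Big),\qquad G^{orlicz}_{h,F_1,F_2}(\psi)=\inf_{g\in\mathcal L_{\psi^*}}V_{h,F_1,F_2}\Big(\psi,\tfrac{(\sqrt{2\pi})^n g}{I(g,\psi^* )}\Big);$$ for $h\in\Psi$ the same with $\inf$ replaced by $\sup$. For $f=e^{-\psi}$: $as^{orlicz}_h(f)=as^{orlicz}_{h,e^{-t},e^{-t}}(\psi)$ and $G^{orlicz}_h(f)=G^{orlicz}_{h,e^{-t},e^{-t}}(\psi)$. $SL_{\pm}(n)$ is the set of linear maps with determinant $\pm1$, $(\psi\circ T)(x)=\psi(Tx)$, and for $f=e^{-\psi}$ invariance means $as^{orlicz}_h(f\circ T)=as^{orlicz}_h(f)$ etc. Standing assumption: all integrals are well defined. *)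

(* Defs.v *)
From HB Require Import structures.
From mathcomp Require Import all_boot all_order all_algebra.
From mathcomp Require Import all_classical all_reals all_analysis.
Set Implicit Arguments.
Unset Strict Implicit.
Unset Printing Implicit Defensive.
Import Order.TTheory GRing.Theory Num.Theory.
Import numFieldNormedType.Exports.
Local Open Scope classical_set_scope.
Local Open Scope ring_scope.

Definition dotv (R : realType) (n : nat) (x y : 'cV[R]_n) : R :=
  \sum_(i < n) x i 0 * y i 0.

Definition enorm (R : realType) (n : nat) (x : 'cV[R]_n) : R :=
  Num.sqrt (dotv x x).

Definition box (R : realType) (n : nat) (a b : 'cV[R]_n) : set 'cV[R]_n :=
  [set x | forall i : 'I_n, a i 0 <= x i 0 <= b i 0].

Definition box_vol (R : realType) (n : nat) (a b : 'cV[R]_n) : R :=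
  \prod_(i < n) Num.max (b i 0 - a i 0) 0.

Definition lebesgue_outer (R : realType) (n : nat) (A : set 'cV[R]_n) : \bar R :=
  ereal_inf [set (\sum_(k <oo) (box_vol (B k).1 (B k).2)%:E)%E
            | B in [set B : nat -> 'cV[R]_n * 'cV[R]_n |
                     A `<=` \bigcup_k box (B k).1 (B k).2]].

Definition lebesgue_measurable_set (R : realType) (n : nat) (A : set 'cV[R]_n) :=
  forall B : set 'cV[R]_n,
    lebesgue_outer B = (lebesgue_outer (B `&` A) + lebesgue_outer (B `&` ~` A))%E.

Definition lebesgue_measurable_fun (R : realType) (n : nat)
    (D : set 'cV[R]_n) (f : 'cV[R]_n -> R) :=
  forall t : R, lebesgue_measurable_set (D `&` [set x | t < f x]).

(* Lebesgue integral over D of a nonnegative function (layer-cake formula,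
   the outer integral being the 1-dimensional Lebesgue integral) *)
Definition integral_nonneg (R : realType) (n : nat)
    (D : set 'cV[R]_n) (f : 'cV[R]_n -> R) : \bar R :=
  (\int[@lebesgue_measure R]_(t in [set t : R | (0 < t)%R])
      lebesgue_outer (D `&` [set x | (t < f x)%R]))%E.

Definition integral_Rn (R : realType) (n : nat)
    (D : set 'cV[R]_n) (f : 'cV[R]_n -> R) : \bar R :=
  (integral_nonneg D (fun x => Num.max (f x) 0)%R
   - integral_nonneg D (fun x => Num.max (- f x) 0)%R)%E.

Definition econvex (R : realType) (n : nat) (psi : 'cV[R]_n -> \bar R) :=
  forall (x y : 'cV[R]_n) (t : R), 0 < t < 1 ->
    (psi ((1 - t) *: x + t *: y)%R <= (1 - t)%:E * psi x + t%:E * psi y)%E.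

Definition class_C (R : realType) (n : nat) (psi : 'cV[R]_n -> \bar R) :=
  [/\ (forall x, psi x != -oo%E), econvex psi &
      exists (x : 'cV[R]_n) (r : R), 0 < r /\
        forall y, enorm (y - x) < r -> (psi y < +oo)%E].

Definition legendre (R : realType) (n : nat) (psi : 'cV[R]_n -> \bar R)
    (y : 'cV[R]_n) : \bar R :=
  ereal_sup [set ((dotv x y)%:E - psi x)%E | x in [set: 'cV[R]_n]].

Definition finite_near (R : realType) (n : nat) (psi : 'cV[R]_n -> \bar R)
    (x : 'cV[R]_n) :=
  exists r : R, 0 < r /\ forall y, enorm (y - x) < r -> psi y \is a fin_num.

Definition has_gradient (R : realType) (n : nat) (psi : 'cV[R]_n -> \bar R)
    (x v : 'cV[R]_n) :=
  finite_near psi x /\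
  forall e : R, 0 < e -> exists d : R, 0 < d /\ forall y, enorm (y - x) < d ->
    `|fine (psi y) - fine (psi x) - dotv v (y - x)| <= e * enorm (y - x).

(* the gradient (where it exists; junk value 0 elsewhere) *)
Definition grad (R : realType) (n : nat) (psi : 'cV[R]_n -> \bar R)
    (x : 'cV[R]_n) : 'cV[R]_n :=
  xget 0 [set v | has_gradient psi x v].

Definition alexandrov_taylor (R : realType) (n : nat) (psi : 'cV[R]_n -> \bar R)
    (x v : 'cV[R]_n) (A : 'M[R]_n) :=
  finite_near psi x /\
  forall e : R, 0 < e -> exists d : R, 0 < d /\ forall y, enorm (y - x) < d ->
    `|fine (psi y) - fine (psi x) - dotv v (y - x)
       - 2^-1 * dotv (A *m (y - x)) (y - x)| <= e * enorm (y - x) ^+ 2.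

Definition alexandrov_hessian (R : realType) (n : nat) (psi : 'cV[R]_n -> \bar R)
    (x : 'cV[R]_n) (A : 'M[R]_n) :=
  A^T = A /\ exists v, alexandrov_taylor psi x v A.

Definition Xset (R : realType) (n : nat) (psi : 'cV[R]_n -> \bar R) : set 'cV[R]_n :=
  [set x | (psi x < +oo)%E /\ exists A, alexandrov_hessian psi x A /\ A \in unitmx].

Definition Iint (R : realType) (n : nat) (g : 'cV[R]_n -> R)
    (psi : 'cV[R]_n -> \bar R) : \bar R :=
  integral_Rn (Xset (legendre psi)) g.

Definition Fplus (R : realType) (n : nat) (psi : 'cV[R]_n -> \bar R)
    : set ('cV[R]_n -> R) :=
  [set g | [/\ lebesgue_measurable_fun (Xset (legendre psi)) g,
              (forall y, Xset (legendre psi) y -> 0 < g y) &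
              (0 < Iint g psi < +oo)%E]].

Definition Lplus (R : realType) (n : nat) (psi : 'cV[R]_n -> \bar R)
    : set ('cV[R]_n -> R) :=
  [set g | Fplus psi g /\
     exists phi : 'cV[R]_n -> \bar R,
       [/\ (forall x, phi x != -oo%E), econvex phi &
           forall y, Xset (legendre psi) y -> (g y)%:E = expeR (- phi y)%E]].

Definition Vfun (R : realType) (n : nat) (h F1 F2 : R -> R)
    (psi : 'cV[R]_n -> \bar R) (g : 'cV[R]_n -> R) : \bar R :=
  integral_Rn (Xset psi) (fun x =>
    h (g (grad psi x) / F2 (dotv x (grad psi x) - fine (psi x)))
    * F1 (fine (psi x))).

Definition normalize (R : realType) (n : nat) (psi : 'cV[R]_n -> \bar R)
    (g : 'cV[R]_n -> R) : 'cV[R]_n -> R :=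
  fun y => (Num.sqrt (2 * pi)) ^+ n * g y / fine (Iint g psi).

(* as^{orlicz} and G^{orlicz}: inf version (h in Phi) and sup version (h in Psi) *)
Definition as_orlicz_inf (R : realType) (n : nat) (h F1 F2 : R -> R)
    (psi : 'cV[R]_n -> \bar R) : \bar R :=
  ereal_inf [set Vfun h F1 F2 psi (normalize psi g) | g in Fplus psi].
Definition as_orlicz_sup (R : realType) (n : nat) (h F1 F2 : R -> R)
    (psi : 'cV[R]_n -> \bar R) : \bar R :=
  ereal_sup [set Vfun h F1 F2 psi (normalize psi g) | g in Fplus psi].
Definition G_orlicz_inf (R : realType) (n : nat) (h F1 F2 : R -> R)
    (psi : 'cV[R]_n -> \bar R) : \bar R :=
  ereal_inf [set Vfun h F1 F2 psi (normalize psi g) | g in Lplus psi].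
Definition G_orlicz_sup (R : realType) (n : nat) (h F1 F2 : R -> R)
    (psi : 'cV[R]_n -> \bar R) : \bar R :=
  ereal_sup [set Vfun h F1 F2 psi (normalize psi g) | g in Lplus psi].

(* ---------- the classes of h (h only matters on (0,oo)) ---------- *)
Definition pos_continuous (R : realType) (h : R -> R) :=
  forall x : R, 0 < x -> 0 < h x /\ {for x, continuous h}.

Definition constant_pos (R : realType) (h : R -> R) :=
  exists c : R, forall x, 0 < x -> h x = c.

Definition strictly_convex_pos (R : realType) (h : R -> R) :=
  forall x y t : R, 0 < x -> 0 < y -> x != y -> 0 < t < 1 ->
    h ((1 - t) * x + t * y) < (1 - t) * h x + t * h y.

Definition strictly_concave_pos (R : realType) (h : R -> R) :=
  forall x y t : R, 0 < x -> 0 < y -> x != y -> 0 < t < 1 ->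
    (1 - t) * h x + t * h y < h ((1 - t) * x + t * y).

Definition increasing_pos (R : realType) (h : R -> R) :=
  forall x y : R, 0 < x -> x < y -> h x < h y.

Definition PhiClass (R : realType) (h : R -> R) :=
  constant_pos h \/ strictly_convex_pos h.

Definition PsiClass (R : realType) (h : R -> R) :=
  constant_pos h \/ (increasing_pos h /\ strictly_concave_pos h).

Definition compT (R : realType) (n : nat) (psi : 'cV[R]_n -> \bar R)
    (T : 'M[R]_n) : 'cV[R]_n -> \bar R :=
  fun x => psi (T *m x).

Definition expneg (R : realType) (t : R) : R := expR (- t).

(* Main.v *)
Require Import Defs.
From HB Require Import structures.
From mathcomp Require Import all_boot all_order all_fingroup all_algebra.
From mathcomp Require Import all_classical all_reals all_analysis.
From mathcomp Require Import measurable_realfun ring lra.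
Set Implicit Arguments.
Unset Strict Implicit.
Unset Printing Implicit Defensive.
Import Order.TTheory GRing.Theory Num.Theory.
Local Open Scope classical_set_scope.
Local Open Scope ring_scope.

(** The inverse transpose of T carries the conjugate of psi to the conjugate of
    psi o T, and T^T carries the gradient of psi at T x to that of psi o T at x.
    Hence g |-> g o T^-T maps the densities admissible for psi to those
    admissible for psi o T, multiplies I by |det T| and V by |det T|^-1; when
    |det T| = 1 the ranges over which the infima and suprema are taken coincide.
    What remains is that preimages under T scale the Lebesgue outer measure by
    |det T|^-1. By the LUP decomposition, every square matrix is a product of
    permutation, diagonal and transvection matrices. The first two map boxes to
    boxes; a transvection maps the slabs into which a box is cut to
    parallelepipeds which are boxes up to an error that vanishes, in total, as
    the number of slabs grows. *)

Section unitmx.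

Lemma preimage_mulmxK (R : comUnitRingType) n p (T : 'M[R]_n)
    (A : set 'M[R]_(n, p)) : T \in unitmx ->
  mulmx (invmx T) @^-1` (mulmx T @^-1` A) = A.
Proof.
by move=> Tu; apply/seteqP; split => x; rewrite /preimage/= mulKVmx.
Qed.

Lemma preimage_mulmxKV (R : comUnitRingType) n p (T : 'M[R]_n)
    (A : set 'M[R]_(n, p)) : T \in unitmx ->
  mulmx T @^-1` (mulmx (invmx T) @^-1` A) = A.
Proof.
by move=> Tu; rewrite -{1}[T]invmxK preimage_mulmxK ?unitmx_inv.
Qed.

Lemma normr_det_gt0 (R : numFieldType) n (T : 'M[R]_n) :
  (0 < `|\det T|) = (T \in unitmx).
Proof. by rewrite normr_gt0 unitmxE unitfE. Qed.

Lemma normr_det1_unitmx (R : numFieldType) n (T : 'M[R]_n) :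
  `|\det T| = 1 -> T \in unitmx.
Proof. by move=> detT; rewrite -normr_det_gt0 detT. Qed.

End unitmx.

Section transvection.
Variables (R : comNzRingType) (n : nat).
Implicit Types (A : 'M[R]_n) (u v : 'rV[R]_n).

Definition transvection (i j : 'I_n) (c : R) : 'M[R]_n :=
  1%:M + c *: delta_mx i j.

Lemma transvectionE i j c (x : 'cV[R]_n) k :
  (transvection i j c *m x) k 0 = x k 0 + (k == i)%:R * (c * x j 0).
Proof.
rewrite mulmxDl mul1mx mxE -scalemxAl mxE; congr (_ + _).
rewrite mulrCA; congr (_ * _); rewrite mxE (bigD1 j)//= big1 => [|l /negbTE lj].
  by rewrite mxE eqxx andbT addr0.
by rewrite mxE lj andbF mul0r.
Qed.

Lemma tr_transvection i j c : (transvection i j c)^T = transvection j i c.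
Proof. by rewrite /transvection linearD linearZ/= trmx1 trmx_delta. Qed.

Lemma det_transvection i j c : i != j -> \det (transvection i j c) = 1.
Proof.
wlog ji : i j / (j < i)%N => [lower|] ij.
  case: (ltngtP i j) => [ij'|ji|/val_inj/eqP]; last by rewrite (negbTE ij).
  - by rewrite -det_tr tr_transvection lower// eq_sym.
  - exact: lower.
rewrite det_trig.
  apply: big1 => k _; rewrite !mxE eqxx (_ : _ && _ = false) ?mulr0 ?addr0//.
  by apply: contraNF ij => /andP[/eqP <- /eqP <-].
apply/is_trig_mxP => k l kl; rewrite !mxE -val_eqE (ltn_eqF kl).
rewrite (_ : _ && _ = false) ?mulr0 ?addr0//.
by apply: contraTF kl => /andP[/eqP -> /eqP ->]; rewrite -leqNgt ltnW.
Qed.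

Definition row_shear (k : 'I_n) u : 'M[R]_n := 1%:M + delta_mx k 0 *m u.

Lemma row_shearD k u v : u 0 k = 0 ->
  row_shear k (u + v) = row_shear k u *m row_shear k v.
Proof.
move=> uk; rewrite /row_shear mulmxDl mul1mx mulmxDr mulmx1 mulmxA.
have -> : delta_mx k 0 *m u *m delta_mx k 0 = 0 :> 'cV[R]_n.
  by rewrite -mulmxA -colE [col k u]mx11_scalar mxE uk raddf0 mulmx0.
by rewrite mul0mx addr0 mulmxDr -addrA [_ *m v + _]addrC.
Qed.

Definition top_rows k A : 'M[R]_n :=
  \matrix_(i, j) (if (i < k)%N then A i j else (i == j)%:R).

Lemma top_rowsS (k : 'I_n) A : is_trig_mx A ->
  top_rows k.+1 A = top_rows k A *m row_shear k (row k A - delta_mx 0 k).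
Proof.
move=> /is_trig_mxP Alow.
have colk : top_rows k A *m delta_mx k 0 = delta_mx k 0 :> 'cV[R]_n.
  rewrite -colE; apply/colP => i; rewrite !mxE andbT; case: ltnP => // ik.
  by rewrite Alow// -val_eqE (ltn_eqF ik).
rewrite /row_shear mulmxDr mulmx1 mulmxA colk; apply/matrixP => i j.
rewrite !mxE big_ord1 !mxE !andbT ltnS leq_eqVlt val_eqE.
case: eqVneq => [->|_]; last by rewrite mul0r addr0.
by rewrite ltnn mul1r [k == j]eq_sym subrKC.
Qed.

End transvection.

Section elementary_factors.
Variables (R : comNzRingType) (n : nat) (P : 'M[R]_n -> Prop).
Hypothesis mulP : forall A B, P A -> P B -> P (A *m B).
Hypothesis transvectionP : forall i j c, i != j -> P (transvection i j c).
Hypothesis diagP : forall d, P (diag_mx d).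

Lemma row_shear_elementary_ind k u : P (row_shear k u).
Proof.
rewrite [u]row_sum_delta (bigD1 k)//= addrC.
pose P_add_uk (v : 'rV[R]_n) :=
  v 0 k = 0 /\ P (row_shear k (v + u 0 k *: delta_mx 0 k)).
suff [] : P_add_uk (\sum_(i < n | i != k) u 0 i *: delta_mx 0 i) by [].
apply: (big_rec P_add_uk) => [|j v jk [vk Pv]].
  rewrite /P_add_uk mxE add0r; split => //.
  rewrite (_ : row_shear _ _ =
    diag_mx (\row_i if i == k then 1 + u 0 k else 1))//.
  apply/matrixP => i l; rewrite /row_shear -scalemxAr mul_delta_mx !mxE.
  have [<-|il] := eqVneq i l.
    by rewrite andbb; case: eqP; rewrite ?mulr1 ?mulr0 ?addr0.
  rewrite (_ : _ && _ = false) ?mulr0 ?addr0//.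
  by apply: contraNF il => /andP[/eqP-> /eqP->].
have jk0 : (u 0 j *: delta_mx 0 j : 'rV[R]_n) 0 k = 0.
  by rewrite !mxE eqxx eq_sym (negbTE jk) mulr0.
split; first by rewrite mxE jk0 vk addr0.
rewrite -addrA row_shearD//; apply: mulP => //.
rewrite /row_shear -scalemxAr mul_delta_mx; apply: transvectionP.
by rewrite eq_sym.
Qed.

Lemma trig_mx_elementary_ind A : is_trig_mx A -> P A.
Proof.
move=> Alow.
suff Ptop k : (k <= n)%N -> P (top_rows k A).
  rewrite (_ : A = top_rows n A); first exact: Ptop.
  by apply/matrixP => i j; rewrite mxE ltn_ord.
elim: k => [_|k IH kn].
  rewrite (_ : top_rows 0 A = diag_mx (const_mx 1)); first exact: diagP.
  by apply/matrixP => i j; rewrite !mxE.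
rewrite (top_rowsS (Ordinal kn) Alow); apply: mulP; first exact/IH/ltnW.
exact: row_shear_elementary_ind.
Qed.

End elementary_factors.

Lemma mx_elementary_ind (F : fieldType) n (P : 'M[F]_n -> Prop) :
    (forall A B, P A -> P B -> P (A *m B)) ->
    (forall i j c, i != j -> P (transvection i j c)) ->
    (forall d, P (diag_mx d)) -> (forall s, P (perm_mx s)) ->
  forall A, P A.
Proof.
case: n P => [|n] P mulP transvectionP diagP permP A.
  by rewrite (_ : A = diag_mx 0)//; apply/matrixP => -[].
have := cormen_lup_correct A; have := cormen_lup_perm A.
have := @cormen_lup_lower _ _ A; have := @cormen_lup_upper _ _ A.
case: cormen_lup => [[_ L] U]/= Uup Llow /is_perm_mxP[s ->] PA.
have -> : A = perm_mx s^-1 *m (L *m U).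
  rewrite [L *m U](_ : _ = L * U)// -PA mulmxA -perm_mxM mulVg.
  by rewrite perm_mx1 mul1mx.
have PL : P L.
  apply: trig_mx_elementary_ind => //; apply/is_trig_mxP => i j ij.
  by rewrite Llow ?(ltnW ij)// -val_eqE (ltn_eqF ij).
suff PU : P U^T^T by apply: (mulP) => //; apply: mulP; rewrite // -[U]trmxK.
pose tr_P B := P B^T.
apply: (@trig_mx_elementary_ind _ _ tr_P) => [B C PB PC|i j c ij|d|].
- by rewrite /tr_P trmx_mul; exact: mulP.
- by rewrite /tr_P tr_transvection; apply: transvectionP; rewrite eq_sym.
- by rewrite /tr_P tr_diag_mx.
- by apply/is_trig_mxP => i j ij; rewrite mxE Uup.
Qed.

Lemma nneseries_nat2 (R : realType) (u : nat * nat -> \bar R)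
    (f : {bij [set: nat] >-> [set: nat * nat]}) : (forall p, 0 <= u p)%E ->
  (\sum_(m <oo) u (f m) = \sum_(i <oo) \sum_(j <oo) u (i, j))%E.
Proof.
move=> u0; rewrite nneseries_esumT// -(@reindex_esum _ _ _ setT setT f u)//.
under eq_eseriesr do rewrite nneseries_esumT//.
rewrite nneseries_esumT => [|i]; last exact: esum_ge0.
rewrite (@esum_esum _ _ _ setT (fun=> setT) (fun i j => u (i, j)))//.
rewrite (_ : _ `*`` _ = setT); last by apply/seteqP; split.
by apply: eq_esum => -[].
Qed.

Section lebesgue_outer_measure.
Variables (R : realType) (n : nat).
Implicit Types (A : set 'cV[R]_n) (a b : 'cV[R]_n).

Lemma box_vol_ge0 a b : 0 <= box_vol a b.
Proof. by apply: prodr_ge0 => i _; rewrite le_max lexx orbT. Qed.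

Lemma box_eq0 a b i : b i 0 < a i 0 -> box a b = set0.
Proof.
move=> ba; apply/seteqP; split => // x /= bx; have /andP[ax xb] := bx i.
by have := le_trans ax xb; rewrite leNgt ba.
Qed.

Lemma lebesgue_outer_ge0 A : (0 <= lebesgue_outer A)%E.
Proof.
apply: le_ereal_inf_tmp => _ [B _ <-].
by apply: nneseries_ge0 => k _ _; rewrite lee_fin box_vol_ge0.
Qed.

Definition box_cover A (B : nat -> 'cV[R]_n * 'cV[R]_n) :=
  A `<=` \bigcup_k box (B k).1 (B k).2.

Definition cover_vol (B : nat -> 'cV[R]_n * 'cV[R]_n) : \bar R :=
  (\sum_(k <oo) (box_vol (B k).1 (B k).2)%:E)%E.

Lemma lebesgue_outer_le_cover A B :
  box_cover A B -> (lebesgue_outer A <= cover_vol B)%E.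
Proof. by move=> AB; apply: ereal_inf_lbound; exists B. Qed.

Lemma lebesgue_outer_near_cover A e : (lebesgue_outer A < +oo)%E -> 0 < e ->
  exists B, box_cover A B /\ (cover_vol B <= lebesgue_outer A + e%:E)%E.
Proof.
move=> Afin e0; have Afin' : lebesgue_outer A \is a fin_num.
  by rewrite ge0_fin_numE ?lebesgue_outer_ge0.
have [_ [B AB <-] ltB] := lb_ereal_inf_adherent e0 Afin'.
by exists B; split => //; exact: ltW.
Qed.

Lemma le_lebesgue_outer :
  {homo @lebesgue_outer R n : A B / A `<=` B >-> (A <= B)%E}.
Proof.
move=> A A' AA'; apply: le_ereal_inf_tmp => _ [B A'B <-].
exact/lebesgue_outer_le_cover/(subset_trans AA').
Qed.

Lemma lebesgue_outer_sigma_subadditive :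
  sigma_subadditive (@lebesgue_outer R n).
Proof.
move=> A; have [[k Akoo]|Afin] :=
  pselect (exists k, lebesgue_outer (A k) = +oo%E).
  rewrite (eseries_pinfty _ _ Akoo) ?leey// => i _.
  by rewrite -ltNye (lt_le_trans _ (lebesgue_outer_ge0 _)).
apply/lee_addgt0Pr => e e0.
apply: le_trans (epsilon_trick _ (fun k => lebesgue_outer_ge0 (A k)) (ltW e0)).
have near_cover k : exists B, box_cover (A k) B /\
    (cover_vol B <= lebesgue_outer (A k) + (e / (2 ^ k.+1)%:R)%:E)%E.
  apply: lebesgue_outer_near_cover; last by rewrite divr_gt0// ltr0n expn_gt0.
  by rewrite ltey; apply/eqP => Akoo; apply: Afin; exists k.
have [B BP] := choice near_cover.
have /card_esym/ppcard_eqP[f] := card_nat2.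
pose vol p := (box_vol (uncurry B p).1 (uncurry B p).2)%:E.
have vol0 p : (0 <= vol p)%E by rewrite lee_fin box_vol_ge0.
apply: (@le_trans _ _ (\sum_(m <oo) vol (f m))%E).
  apply: (@lebesgue_outer_le_cover _ (uncurry B \o f)).
  move=> x [k _ /(proj1 (BP k))[m _ Bx]].
  by exists (f^-1%FUN (k, m)) => //=; rewrite invK ?inE.
rewrite nneseries_nat2//; apply: lee_nneseries => [k _ _|k _].
  exact: nneseries_ge0.
exact: (proj2 (BP k)).
Qed.

End lebesgue_outer_measure.

(* In dimension 0 every box has volume 1, so that the outer measure of any set
   is +oo: the next facts fail there. *)
Section lebesgue_outer_positive_dimension.
Variables (R : realType) (n : nat).
Implicit Types (a b : 'cV[R]_n.+1).

Let empty_box : 'cV[R]_n.+1 * 'cV[R]_n.+1 := (const_mx 1, const_mx 0).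

Let box_vol_empty_box : box_vol empty_box.1 empty_box.2 = 0.
Proof. by rewrite /box_vol big_ord_recl !mxE sub0r max_r ?mul0r. Qed.

Lemma lebesgue_outer_set0 : lebesgue_outer (set0 : set 'cV[R]_n.+1) = 0%E.
Proof.
apply/eqP; rewrite eq_le lebesgue_outer_ge0 andbT.
apply: le_trans (@lebesgue_outer_le_cover _ _ _ (fun=> empty_box) _) _ => //.
by rewrite /cover_vol eseries0// => k _ _; rewrite box_vol_empty_box.
Qed.

HB.instance Definition _ := isOuterMeasure.Build R 'cV[R]_n.+1
  (@lebesgue_outer R n.+1) lebesgue_outer_set0 (@lebesgue_outer_ge0 R n.+1)
  (@le_lebesgue_outer R n.+1) (@lebesgue_outer_sigma_subadditive R n.+1).

Lemma lebesgue_outer_box_le a b :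
  (lebesgue_outer (box a b) <= (box_vol a b)%:E)%E.
Proof.
pose B k := if k is 0%N then (a, b) else empty_box.
apply: le_trans (@lebesgue_outer_le_cover _ _ _ B _) _.
  by move=> x abx; exists 0%N.
rewrite /cover_vol nneseries_recl// => [|k _]; last first.
  by rewrite lee_fin box_vol_ge0.
rewrite eseries_cond eseries0 ?adde0// => -[//|k] _ _.
by rewrite box_vol_empty_box.
Qed.

End lebesgue_outer_positive_dimension.

Section subscaling.
Variable R : realType.

Definition outer_subscaling n (T : 'M[R]_n) := forall A : set 'cV[R]_n,
  (`|\det T|%:E * lebesgue_outer (mulmx T @^-1` A) <= lebesgue_outer A)%E.

Lemma outer_subscaling_dim0 (T : 'M[R]_0) : outer_subscaling T.
Proof.
move=> A; rewrite det_mx00 normr1 mul1e; apply: le_lebesgue_outer => x.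
by rewrite /preimage/= (_ : T *m x = x)//; apply/matrixP => -[].
Qed.

Lemma outer_subscaling_mul n (S T : 'M[R]_n) :
  outer_subscaling S -> outer_subscaling T -> outer_subscaling (S *m T).
Proof.
move=> Ssub Tsub A; apply: le_trans (Ssub A).
rewrite det_mulmx normrM EFinM -muleA lee_wpmul2l ?lee_fin//.
apply: le_trans (Tsub _); rewrite (_ : mulmx (S *m T) @^-1` A =
  mulmx T @^-1` (mulmx S @^-1` A))//.
by apply/seteqP; split => x; rewrite /preimage/= mulmxA.
Qed.

Lemma outer_subscaling_box n (T : 'M[R]_n.+1) :
    (forall a b : 'cV[R]_n.+1, (forall i, a i 0 <= b i 0) ->
      (`|\det T|%:E * lebesgue_outer (mulmx T @^-1` box a b)
        <= (box_vol a b)%:E)%E) ->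
  outer_subscaling T.
Proof.
move=> Tbox A; apply: le_ereal_inf_tmp => _ [B AB <-].
apply: (@le_trans _ _ (`|\det T|%:E *
    \sum_(k <oo) lebesgue_outer (mulmx T @^-1` box (B k).1 (B k).2))%E).
  rewrite lee_wpmul2l ?lee_fin//.
  apply: le_trans (lebesgue_outer_sigma_subadditive _).
  by rewrite -preimage_bigcup; apply: le_lebesgue_outer => x; exact: AB.
rewrite -nneseriesZl => [|k _]; last exact: lebesgue_outer_ge0.
apply: lee_nneseries => [k _ _|k _].
  by rewrite mule_ge0 ?lebesgue_outer_ge0.
have [ab|] := pselect (forall i, (B k).1 i 0 <= (B k).2 i 0); first exact: Tbox.
move=> /existsNP[i /negP]; rewrite -ltNge => /box_eq0 ->.
by rewrite preimage_set0 lebesgue_outer_set0 mule0 lee_fin box_vol_ge0.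
Qed.

Lemma outer_subscaling_preimage_box n (T : 'M[R]_n.+1) :
    (forall a b : 'cV[R]_n.+1, (forall i, a i 0 <= b i 0) ->
      exists lo hi, mulmx T @^-1` box a b `<=` box lo hi /\
        `|\det T| * box_vol lo hi = box_vol a b) ->
  outer_subscaling T.
Proof.
move=> Tbox; apply: outer_subscaling_box => a b /Tbox[lo [hi [Tab <-]]].
apply: (@le_trans _ _ (`|\det T|%:E * (box_vol lo hi)%:E)%E).
  rewrite lee_wpmul2l ?lee_fin//; apply: le_trans (lebesgue_outer_box_le _ _).
  exact: le_lebesgue_outer.
by rewrite EFinM.
Qed.

Lemma outer_subscaling_perm n (s : 'S_n) :
  outer_subscaling (perm_mx s : 'M[R]_n).
Proof.
case: n s => [|n] s; first exact: outer_subscaling_dim0.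
apply: outer_subscaling_preimage_box => a b ab.
pose unperm (c : 'cV[R]_n.+1) := row_perm s^-1 c.
exists (unperm a), (unperm b); split.
  move=> x /= abx i; rewrite !mxE; have := abx (s^-1 i)%g.
  by rewrite -row_permE mxE permKV.
rewrite det_perm normrX normrN1 expr1n mul1r.
by rewrite [LHS](reindex_perm s)/=; apply: eq_bigr => i _; rewrite !mxE permK.
Qed.

(* With [m] the centre and [r] half the length of the i-th side of the box,
   [`|d t - m| <= r] means [`|t - m / d| <= r / `|d|]. *)
Lemma outer_subscaling_diag n (d : 'rV[R]_n) : outer_subscaling (diag_mx d).
Proof.
case: n d => [|n] d; first exact: outer_subscaling_dim0.
have [det0|] := eqVneq (\det (diag_mx d)) 0.
  by move=> A; rewrite det0 normr0 mul0e lebesgue_outer_ge0.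
rewrite det_diag => /prodf_neq0 d0.
apply: outer_subscaling_preimage_box => a b ab.
pose m i := (a i 0 + b i 0) / 2; pose r i := (b i 0 - a i 0) / 2.
exists (\col_i (m i / d 0 i - r i / `|d 0 i|)),
       (\col_i (m i / d 0 i + r i / `|d 0 i|)); split.
  move=> x /= abx i; rewrite !mxE.
  have : `|d 0 i * x i 0 - m i| <= r i.
    have := abx i; rewrite mul_diag_mx mxE ler_norml /m /r.
    by move=> /andP[lo hi]; apply/andP; split; lra.
  have -> : d 0 i * x i 0 - m i = d 0 i * (x i 0 - m i / d 0 i).
    by rewrite mulrBr mulrCA divff ?mulr1// d0.
  by rewrite normrM mulrC -ler_pdivlMr ?normr_gt0 ?d0// ler_distl.
rewrite det_diag normr_prod /box_vol -big_split/=; apply: eq_bigr => i _.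
rewrite !mxE maxr_pMr// mulr0 /m /r; congr Num.max; field.
by rewrite normr_eq0 d0.
Qed.

End subscaling.

Section subdivision.
Variables (R : realFieldType) (N : nat).
Implicit Types (s t x : R).

Definition subdivision s t (m : nat) : R := s + m%:R * ((t - s) / N.+1%:R).

Lemma subdivisionS s t m :
  subdivision s t m.+1 - subdivision s t m = (t - s) / N.+1%:R.
Proof. by rewrite /subdivision -natr1; ring. Qed.

Lemma subdivision_cover s t x : s <= x <= t ->
  exists2 m, (m < N.+1)%N & subdivision s t m <= x <= subdivision s t m.+1.
Proof.
rewrite /subdivision => /andP[sx xt]; set d := (t - s) / N.+1%:R.
have cover_upto k : x <= s + k.+1%:R * d ->
    exists2 m, (m < k.+1)%N & s + m%:R * d <= x <= s + m.+1%:R * d.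
  elim: k => [|k IH] xk; first by exists 0%N; rewrite // mul0r addr0 sx.
  have [/IH[m mk mx]|kx] := leP x (s + k.+1%:R * d).
    by exists m => //; exact: ltnW.
  by exists k.+1 => //; rewrite ltW.
by apply: cover_upto; rewrite mulrC divfK ?subrKC ?pnatr_eq0.
Qed.

End subdivision.

Section slabs.
Variables (R : realType) (n : nat).
Implicit Types (a b x : 'cV[R]_n) (i j k : 'I_n) (s t : R).

Definition set_coord j s x : 'cV[R]_n := \col_k (if k == j then s else x k 0).

Definition face_vol j a b : R :=
  \prod_(k < n | k != j) Num.max (b k 0 - a k 0) 0.

Lemma face_vol_ge0 j a b : 0 <= face_vol j a b.
Proof. by apply: prodr_ge0 => k _; rewrite le_max lexx orbT. Qed.

Lemma box_volD1 j a b :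
  box_vol a b = Num.max (b j 0 - a j 0) 0 * face_vol j a b.
Proof. by rewrite /box_vol (bigD1 j). Qed.

Lemma box_vol_set_coord j s t a b :
  box_vol (set_coord j s a) (set_coord j t b) =
  Num.max (t - s) 0 * face_vol j a b.
Proof.
rewrite (box_volD1 j) !mxE eqxx; congr (_ * _).
by apply: eq_bigr => k /negbTE kj; rewrite !mxE kj.
Qed.

Lemma face_volD1 i j a b : i != j -> face_vol i a b =
  Num.max (b j 0 - a j 0) 0 *
  \prod_(k < n | (k != i) && (k != j)) Num.max (b k 0 - a k 0) 0.
Proof. by move=> ij; rewrite /face_vol (bigD1 j)// eq_sym. Qed.

Variable N : nat.

Definition slab_lo j a b m :=
  set_coord j (subdivision N (a j 0) (b j 0) m) a.

Definition slab_hi j a b m :=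
  set_coord j (subdivision N (a j 0) (b j 0) m.+1) b.

Lemma box_sub_slabs j a b :
  box a b `<=` \bigcup_(m < N.+1) box (slab_lo j a b m) (slab_hi j a b m).
Proof.
move=> x abx; have [m mN mx] := subdivision_cover N (abx j).
by exists m => // k; rewrite !mxE; case: eqP => [->|_].
Qed.

Lemma slab_side j a b m :
  slab_hi j a b m j 0 - slab_lo j a b m j 0 = (b j 0 - a j 0) / N.+1%:R.
Proof. by rewrite !mxE eqxx subdivisionS. Qed.

Lemma slab_vol j a b m :
  box_vol (slab_lo j a b m) (slab_hi j a b m) = box_vol a b / N.+1%:R.
Proof.
rewrite box_vol_set_coord subdivisionS (box_volD1 j a b) mulrAC.
by rewrite [in RHS]maxr_pMl// mul0r.
Qed.

Lemma slab_face_vol i j a b m : i != j ->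
  face_vol i (slab_lo j a b m) (slab_hi j a b m) = face_vol i a b / N.+1%:R.
Proof.
move=> ij; rewrite !(face_volD1 _ _ ij) slab_side mulrAC.
rewrite [in RHS]maxr_pMl// mul0r; congr (_ * _).
apply: eq_bigr => k /andP[_ /negbTE kj].
by rewrite !mxE kj.
Qed.

End slabs.

Section transvection_subscaling.
Variables (R : realType) (n : nat) (i j : 'I_n.+1) (c : R).
Hypothesis ij : i != j.
Implicit Types (a b : 'cV[R]_n.+1).

(* The preimage is a box sheared along the i-th axis: over the interval
   [a j, b j], the shear displaces it by [c m] up to [`|c|] times half the
   length, where [m] is the centre. *)
Lemma lebesgue_outer_transvection_box_le a b :
    a i 0 <= b i 0 -> a j 0 <= b j 0 ->
  (lebesgue_outer (mulmx (transvection i j c) @^-1` box a b) <=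
   (box_vol a b + `|c| * (b j 0 - a j 0) * face_vol i a b)%:E)%E.
Proof.
move=> abi abj; pose m := (a j 0 + b j 0) / 2; pose r := (b j 0 - a j 0) / 2.
pose lo := set_coord i (a i 0 - c * m - `|c| * r) a.
pose hi := set_coord i (b i 0 - c * m + `|c| * r) b.
apply: (@le_trans _ _ (lebesgue_outer (box lo hi))).
  apply: le_lebesgue_outer => x abx k; have := abx k.
  rewrite transvectionE !mxE.
  have [->|_] := eqVneq k i; last by rewrite mul0r addr0.
  have /ler_normlP[] : `|c * (x j 0 - m)| <= `|c| * r.
    rewrite normrM ler_wpM2l// ler_norml /m /r.
    have := abx j; rewrite transvectionE eq_sym (negbTE ij) mul0r addr0.
    by move=> /andP[? ?]; apply/andP; split; lra.
  by rewrite mul1r => ? ? /andP[? ?]; apply/andP; split; lra.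
apply: le_trans (lebesgue_outer_box_le _ _) _.
have r0 : 0 <= `|c| * r by rewrite mulr_ge0// divr_ge0// subr_ge0.
rewrite lee_fin box_vol_set_coord (box_volD1 i a b) !max_l; [|lra|lra].
by rewrite -mulrDl ler_wpM2r ?face_vol_ge0// /r; lra.
Qed.

Lemma lebesgue_outer_transvection_box_le_slabs N a b :
    (forall k, a k 0 <= b k 0) ->
  (lebesgue_outer (mulmx (transvection i j c) @^-1` box a b) <=
   (box_vol a b +
    `|c| * (b j 0 - a j 0) * face_vol i a b / N.+1%:R)%:E)%E.
Proof.
move=> ab; pose slab m := box (slab_lo N j a b m) (slab_hi N j a b m).
apply: (@le_trans _ _ (\sum_(m < N.+1)
    lebesgue_outer (mulmx (transvection i j c) @^-1` slab m))%E).
  apply: le_trans (outer_measure_subadditive _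
    (fun m => mulmx (transvection i j c) @^-1` slab m) _).
  rewrite -(bigcup_mkord _ (fun m => _ @^-1` slab m)) -preimage_bigcup.
  by apply: le_lebesgue_outer => x; exact: box_sub_slabs.
apply: (@le_trans _ _ (\sum_(m < N.+1) (box_vol a b / N.+1%:R +
    `|c| * ((b j 0 - a j 0) / N.+1%:R) * (face_vol i a b / N.+1%:R))%:E)%E).
  apply: lee_sum => m _.
  rewrite -(slab_vol N j a b m) -(slab_side N j a b m).
  rewrite -(slab_face_vol N a b m ij).
  apply: lebesgue_outer_transvection_box_le.
    by rewrite !mxE (negbTE ij).
  by rewrite -subr_ge0 slab_side divr_ge0// subr_ge0.
rewrite sumEFin sumr_const card_ord lee_fin -mulr_natr.
rewrite le_eqVlt; apply/orP; left; apply/eqP; field.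
by rewrite nat1r pnatr_eq0.
Qed.

Lemma outer_subscaling_transvection : outer_subscaling (transvection i j c).
Proof.
apply: outer_subscaling_box => a b ab.
rewrite det_transvection// normr1 mul1e.
set K := `|c| * (b j 0 - a j 0) * face_vol i a b.
have K0 : 0 <= K by rewrite !mulr_ge0 ?face_vol_ge0// subr_ge0.
apply/lee_addgt0Pr => e e0; pose N := Num.bound (K / e).
apply: le_trans (lebesgue_outer_transvection_box_le_slabs N ab) _.
rewrite -EFinD lee_fin lerD2l ler_pdivrMr ?ltr0n// -ler_pdivrMl// mulrC.
have /archi_boundP/ltW/le_trans : 0 <= K / e by rewrite divr_ge0// ltW.
by apply; rewrite ler_nat.
Qed.

End transvection_subscaling.

Section linear_images.
Variables (R : realType) (n : nat).
Implicit Types (T : 'M[R]_n) (A : set 'cV[R]_n).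

Lemma outer_subscaling_mx T : outer_subscaling T.
Proof.
apply: (@mx_elementary_ind R n (@outer_subscaling R n)).
- exact: outer_subscaling_mul.
- case: n => [[]//|m] i j c ij; exact: outer_subscaling_transvection.
- exact: outer_subscaling_diag.
- exact: outer_subscaling_perm.
Qed.

Lemma lebesgue_outer_preimage_mulmx T A : T \in unitmx ->
  lebesgue_outer (mulmx T @^-1` A) = (`|\det T|^-1%:E * lebesgue_outer A)%E.
Proof.
move=> Tu; have detT : 0 < `|\det T| by rewrite normr_det_gt0.
apply/eqP; rewrite eq_le lee_pdivlMl// outer_subscaling_mx/=.
have := outer_subscaling_mx (invmx T) (mulmx T @^-1` A).
by rewrite preimage_mulmxK// det_inv normfV.
Qed.

End linear_images.

Lemma nonincreasing_emeasurable (R : realType) (D : set R) (f : R -> \bar R) :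
  measurable D -> {homo f : s t / (s <= t)%R >-> (t <= s)%E} ->
  measurable_fun D f.
Proof.
move=> mD f_ni.
apply: (measurability _ (ErealGenCInfty.measurableE R)) => _ [_ [r ->] <-].
apply: measurableI => //; apply: is_interval_measurable => s t /=.
rewrite !in_itv/= !andbT => _ ft u /andP[_ ut].
by rewrite in_itv/= andbT (le_trans ft)// f_ni.
Qed.

Lemma EFin_muleBr (R : realDomainType) (c : R) (x y : \bar R) : (0 < c)%R ->
  (c%:E * (x - y) = c%:E * x - c%:E * y)%E.
Proof.
move=> c0; case: x y => [x| |] [y| |];
  rewrite /= ?gt0_muley ?gt0_muleNy ?lte_fin//=.
by rewrite -EFinB -!EFinM -EFinB mulrBr.
Qed.

Section integrals.
Variables (R : realType) (n : nat).
Implicit Types (T : 'M[R]_n) (D : set 'cV[R]_n) (f : 'cV[R]_n -> R).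

Lemma lebesgue_measurable_set_mulmx T D : T \in unitmx ->
  lebesgue_measurable_set D -> lebesgue_measurable_set (mulmx T @^-1` D).
Proof.
move=> Tu mD B; rewrite -[B](preimage_mulmxKV _ Tu).
rewrite preimage_setC -!preimage_setI !(lebesgue_outer_preimage_mulmx _ Tu).
by rewrite -ge0_muleDr ?lebesgue_outer_ge0// -mD.
Qed.

Lemma lebesgue_measurable_fun_mulmx T D f : T \in unitmx ->
  lebesgue_measurable_fun D f ->
  lebesgue_measurable_fun (mulmx T @^-1` D) (f \o mulmx T).
Proof. by move=> Tu mf t; exact: (lebesgue_measurable_set_mulmx Tu (mf t)). Qed.

Lemma integral_nonneg_mulmx T D f : T \in unitmx ->
  integral_nonneg (mulmx T @^-1` D) (f \o mulmx T) =
  (`|\det T|^-1%:E * integral_nonneg D f)%E.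
Proof.
have mpos : measurable [set t : R | 0 < t] by rewrite -set_itvoy.
move=> Tu; rewrite -ge0_integralZl_EFin//.
- apply: eq_integral => t _.
  exact: (lebesgue_outer_preimage_mulmx (D `&` [set x | t < f x]) Tu).
- by move=> t _; exact: lebesgue_outer_ge0.
- apply: nonincreasing_emeasurable => // s t st.
  apply: le_lebesgue_outer => x [Dx /=]; split => //.
  exact: le_lt_trans st _.
Qed.

Lemma integral_Rn_mulmx T D f : T \in unitmx ->
  integral_Rn (mulmx T @^-1` D) (f \o mulmx T) =
  (`|\det T|^-1%:E * integral_Rn D f)%E.
Proof.
move=> Tu; rewrite EFin_muleBr ?invr_gt0 ?normr_det_gt0//.
by rewrite -!integral_nonneg_mulmx.
Qed.

End integrals.

Section euclidean.
Variables (R : realType) (n : nat).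
Implicit Types (x y u v w : 'cV[R]_n) (T : 'M[R]_n) (r s : 'cV[R]_n -> R).

Lemma dotvE x y : dotv x y = (x^T *m y) 0 0.
Proof. by rewrite mxE; apply: eq_bigr => i _; rewrite mxE. Qed.

Lemma dotv_mulmxl T x y : dotv (T *m x) y = dotv x (T^T *m y).
Proof. by rewrite !dotvE trmx_mul mulmxA. Qed.

Lemma dotvBl u v w : dotv (u - v) w = dotv u w - dotv v w.
Proof. by rewrite !dotvE linearB/= mulmxBl !mxE. Qed.

Lemma dotvZr c u v : dotv u (c *: v) = c * dotv u v.
Proof. by rewrite !dotvE -scalemxAr mxE. Qed.

Lemma dotvZl c u v : dotv (c *: u) v = c * dotv u v.
Proof. by rewrite !dotvE linearZ/= -scalemxAl mxE. Qed.

Lemma dotvv_ge0 x : 0 <= dotv x x.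
Proof. by apply: sumr_ge0 => i _; rewrite -expr2 sqr_ge0. Qed.

Lemma enorm_ge0 x : 0 <= enorm x.
Proof. exact: sqrtr_ge0. Qed.

Lemma enorm_sqr x : enorm x ^+ 2 = dotv x x.
Proof. by rewrite sqr_sqrtr// dotvv_ge0. Qed.

Lemma enormZ c x : enorm (c *: x) = `|c| * enorm x.
Proof.
by rewrite /enorm dotvZl dotvZr mulrA -expr2 sqrtrM ?sqr_ge0// sqrtr_sqr.
Qed.

Lemma coord_le_enorm x i : `|x i 0| <= enorm x.
Proof.
rewrite -sqrtr_sqr ler_sqrt ?dotvv_ge0// /dotv (bigD1 i)//= -expr2 lerDl.
by apply: sumr_ge0 => k _; rewrite -expr2 sqr_ge0.
Qed.

Lemma enorm_eq0 x : enorm x = 0 -> x = 0.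
Proof.
move=> x0; apply/colP => i; apply/eqP.
by rewrite mxE -normr_le0 -x0 coord_le_enorm.
Qed.

Lemma enorm_le_sum x : enorm x <= \sum_i `|x i 0|.
Proof.
have s0 : 0 <= \sum_i `|x i 0| by apply: sumr_ge0.
rewrite -[leRHS]ger0_norm// -sqrtr_sqr ler_sqrt ?sqr_ge0//.
rewrite expr2 mulr_suml; apply: ler_sum => i _.
rewrite -expr2 -real_normK ?num_real// expr2 ler_wpM2l//.
by rewrite (bigD1 i)//= lerDl; apply: sumr_ge0.
Qed.

Lemma enorm_mulmx_bound T :
  exists2 M, 0 < M & forall x, enorm (T *m x) <= M * enorm x.
Proof.
pose M := \sum_i \sum_j `|T i j|.
have M0 : 0 <= M by apply: sumr_ge0 => i _; apply: sumr_ge0.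
exists (M + 1) => [|x]; first by rewrite ltr_wpDl.
apply: (@le_trans _ _ (M * enorm x)); last first.
  by rewrite ler_wpM2r ?enorm_ge0// lerDl.
apply: le_trans (enorm_le_sum _) _; rewrite mulr_suml; apply: ler_sum => i _.
rewrite mxE mulr_suml; apply: le_trans (ler_norm_sum _ _ _) _.
by apply: ler_sum => j _; rewrite normrM ler_wpM2l// coord_le_enorm.
Qed.

Definition enorm_smallo (p : nat) x r := forall e, 0 < e ->
  exists d, 0 < d /\ forall y, enorm (y - x) < d ->
    `|r y| <= e * enorm (y - x) ^+ p.

Lemma enorm_smalloB p x r s :
  enorm_smallo p x r -> enorm_smallo p x s -> enorm_smallo p x (r \- s).
Proof.
move=> rx sx e e0; have e20 : 0 < e / 2 by rewrite divr_gt0.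
have [d1 [d10 rd1]] := rx _ e20; have [d2 [d20 sd2]] := sx _ e20.
exists (Num.min d1 d2); split => [|y]; first by rewrite lt_min d10.
rewrite lt_min => /andP[/rd1 ry /sd2 sy].
by rewrite [e]splitr mulrDl (le_trans (ler_normB _ _))// lerD.
Qed.

Lemma enorm_smallo_mulmx p T x r :
  enorm_smallo p (T *m x) r -> enorm_smallo p x (r \o mulmx T).
Proof.
move=> rTx e e0; have [M M0 TM] := enorm_mulmx_bound T.
have [|d [d0 rd]] := rTx (e / M ^+ p); first by rewrite divr_gt0// exprn_gt0.
exists (d / M); split => [|y yx]; first by rewrite divr_gt0.
have TyxM : enorm (T *m y - T *m x) <= M * enorm (y - x) by rewrite -mulmxBr.
have /rd/le_trans : enorm (T *m y - T *m x) < d.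
  by apply: le_lt_trans TyxM _; rewrite mulrC -ltr_pdivlMr.
apply; rewrite -mulrA ler_pM2l// ler_pdivrMl ?exprn_gt0// -exprMn.
by rewrite lerXn2r// ?nnegrE ?enorm_ge0// mulr_ge0 ?enorm_ge0// ltW.
Qed.

Lemma dotv_smallo1_eq0 x u :
  enorm_smallo 1 x (fun y => dotv u (y - x)) -> u = 0.
Proof.
move=> ux; apply: enorm_eq0; apply/eqP; rewrite eq_le enorm_ge0 andbT.
rewrite leNgt; apply/negP => u0.
have [|d [d0 ud]] := ux (enorm u / 2); first by rewrite divr_gt0.
pose t := d / 2 / enorm u; have t0 : 0 < t by rewrite !divr_gt0.
have tu : enorm (x + t *: u - x) = t * enorm u.
  by rewrite addrC addKr enormZ gtr0_norm.
have /ud : enorm (x + t *: u - x) < d.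
  by rewrite tu divfK ?gt_eqF// ltr_pdivrMr// ltr_pMr// ltr1n.
rewrite tu addrC addKr dotvZr -enorm_sqr expr1 ger0_norm.
  by rewrite expr2 mulrA [leRHS]mulrC ler_pM2l ?(mulr_gt0 t0 u0)// => ?; lra.
by rewrite mulr_ge0 ?exprn_ge0 ?enorm_ge0// ltW.
Qed.

End euclidean.

Section linear_substitution.
Variables (R : realType) (n : nat).
Implicit Types (psi : 'cV[R]_n -> \bar R) (T : 'M[R]_n) (x v : 'cV[R]_n).

Lemma compT_invmx psi T : T \in unitmx -> compT (compT psi T) (invmx T) = psi.
Proof. by move=> Tu; apply/funext => x; rewrite /compT mulKVmx. Qed.

Lemma econvex_compT psi T : econvex psi -> econvex (compT psi T).
Proof.
by move=> cvx x y t t01; rewrite /compT mulmxDr -!scalemxAr; exact: cvx.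
Qed.

Lemma finite_near_compT psi T x :
  finite_near psi (T *m x) -> finite_near (compT psi T) x.
Proof.
move=> [r [r0 fr]]; have [M M0 TM] := enorm_mulmx_bound T.
exists (r / M); split => [|y yx]; first by rewrite divr_gt0.
apply: fr; rewrite -mulmxBr; apply: le_lt_trans (TM _) _.
by rewrite mulrC -ltr_pdivlMr.
Qed.

Definition gradient_remainder psi x v y : R :=
  fine (psi y) - fine (psi x) - dotv v (y - x).

Definition taylor_remainder psi x v (A : 'M[R]_n) y : R :=
  gradient_remainder psi x v y - 2^-1 * dotv (A *m (y - x)) (y - x).

Lemma has_gradientE psi x v : has_gradient psi x v =
  (finite_near psi x /\ enorm_smallo 1 x (gradient_remainder psi x v)).
Proof. by []. Qed.

Lemma alexandrov_taylorE psi x v A : alexandrov_taylor psi x v A =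
  (finite_near psi x /\ enorm_smallo 2 x (taylor_remainder psi x v A)).
Proof. by []. Qed.

Lemma gradient_remainder_compT psi T x v :
  gradient_remainder (compT psi T) x (T^T *m v) =
  gradient_remainder psi (T *m x) v \o mulmx T.
Proof.
apply/funext => y; rewrite /gradient_remainder /=.
by rewrite dotv_mulmxl trmxK mulmxBr.
Qed.

Lemma taylor_remainder_compT psi T x v A :
  taylor_remainder (compT psi T) x (T^T *m v) (T^T *m A *m T) =
  taylor_remainder psi (T *m x) v A \o mulmx T.
Proof.
apply/funext => y; rewrite /taylor_remainder gradient_remainder_compT/=.
by rewrite -!mulmxA dotv_mulmxl trmxK mulmxBr.
Qed.

Lemma has_gradient_compT psi T x v :
  has_gradient psi (T *m x) v -> has_gradient (compT psi T) x (T^T *m v).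
Proof.
rewrite !has_gradientE gradient_remainder_compT => -[fin smallo].
by split; [exact: finite_near_compT|exact: enorm_smallo_mulmx].
Qed.

Lemma alexandrov_taylor_compT psi T x v A :
  alexandrov_taylor psi (T *m x) v A ->
  alexandrov_taylor (compT psi T) x (T^T *m v) (T^T *m A *m T).
Proof.
rewrite !alexandrov_taylorE taylor_remainder_compT => -[fin smallo].
by split; [exact: finite_near_compT|exact: enorm_smallo_mulmx].
Qed.

Lemma has_gradient_unique psi x v w :
  has_gradient psi x v -> has_gradient psi x w -> v = w.
Proof.
rewrite !has_gradientE => -[_ vx] [_ wx].
apply/eqP; rewrite -subr_eq0; apply/eqP.
apply: (@dotv_smallo1_eq0 _ _ x); move: (enorm_smalloB wx vx).
rewrite (_ : _ \- _ = fun y => dotv (v - w) (y - x))//.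
by apply/funext => y /=; rewrite dotvBl /gradient_remainder; ring.
Qed.

Lemma gradE psi x v : has_gradient psi x v -> grad psi x = v.
Proof.
move=> gv; apply: (has_gradient_unique _ gv).
exact: (@xgetI _ 0 [set v | has_gradient psi x v] v).
Qed.

Lemma grad_compT psi T x : T \in unitmx ->
  grad (compT psi T) x = T^T *m grad psi (T *m x).
Proof.
move=> Tu; have [[v gv]|nograd] :=
  pselect (exists v, has_gradient psi (T *m x) v).
  by rewrite (gradE gv); apply: gradE; exact: has_gradient_compT.
rewrite /grad !xgetPN ?mulmx0// => v gv; apply: nograd; first by exists v.
exists ((invmx T)^T *m v).
have := @has_gradient_compT (compT psi T) (invmx T) (T *m x) v.
by rewrite compT_invmx// mulKmx//; exact.
Qed.

Lemma Xset_compT psi T : T \in unitmx ->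
  Xset (compT psi T) = mulmx T @^-1` Xset psi.
Proof.
have sub_Xset psi' S : S \in unitmx ->
    mulmx S @^-1` Xset psi' `<=` Xset (compT psi' S).
  move=> Su x [fin [A [[AT [v Av]] Au]]]; split=> //.
  exists (S^T *m A *m S); split; last by rewrite !unitmx_mul unitmx_tr Su Au.
  split; first by rewrite !trmx_mul trmxK AT mulmxA.
  by exists (S^T *m v); exact: alexandrov_taylor_compT.
move=> Tu; apply/seteqP; split; last exact: sub_Xset.
move=> x Xx; have := sub_Xset (compT psi T) (invmx T) _ (T *m x).
by rewrite unitmx_inv compT_invmx// /preimage/= mulKmx//; apply.
Qed.

Lemma legendre_compT psi T : T \in unitmx ->
  legendre (compT psi T) = compT (legendre psi) (invmx T)^T.
Proof.
move=> Tu; apply/funext => y; rewrite /legendre /compT.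
congr ereal_sup; apply/seteqP; split => _ [x _ <-].
  by exists (T *m x) => //; rewrite dotv_mulmxl trmx_inv mulKVmx ?unitmx_tr.
exists (invmx T *m x) => //.
by rewrite mulKVmx// dotv_mulmxl.
Qed.

Lemma Xset_legendre_compT psi T : T \in unitmx ->
  Xset (legendre (compT psi T)) = mulmx (invmx T)^T @^-1` Xset (legendre psi).
Proof.
by move=> Tu; rewrite legendre_compT// Xset_compT// unitmx_tr unitmx_inv.
Qed.

End linear_substitution.

Section orlicz.
Variables (R : realType) (n : nat).
Implicit Types (psi : 'cV[R]_n -> \bar R) (T : 'M[R]_n) (g : 'cV[R]_n -> R).

Definition dual_comp g T : 'cV[R]_n -> R := g \o mulmx (invmx T)^T.

Lemma Iint_compT psi T g : T \in unitmx ->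
  Iint (dual_comp g T) (compT psi T) = (`|\det T|%:E * Iint g psi)%E.
Proof.
move=> Tu; rewrite /Iint Xset_legendre_compT// integral_Rn_mulmx.
  by rewrite det_tr det_inv normfV invrK.
by rewrite unitmx_tr unitmx_inv.
Qed.

Lemma Fplus_compT psi T g : T \in unitmx ->
  Fplus psi g -> Fplus (compT psi T) (dual_comp g T).
Proof.
move=> Tu [mg g0 /andP[I0 Ioo]]; split.
- rewrite Xset_legendre_compT//; apply: lebesgue_measurable_fun_mulmx => //.
  by rewrite unitmx_tr unitmx_inv.
- by rewrite Xset_legendre_compT// => y; exact: g0.
- have detT : 0 < `|\det T| by rewrite normr_det_gt0.
  by rewrite Iint_compT// mule_gt0//= lte_mul_pinfty// ltW// ltry.
Qed.

Lemma Lplus_compT psi T g : T \in unitmx ->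
  Lplus psi g -> Lplus (compT psi T) (dual_comp g T).
Proof.
move=> Tu [Fg [phi [phiNy phi_cvx gE]]]; split; first exact: Fplus_compT.
exists (compT phi (invmx T)^T); split; first by move=> x; exact: phiNy.
- exact: econvex_compT.
- by rewrite Xset_legendre_compT// => y; exact: gE.
Qed.

Lemma Vfun_compT h F1 F2 psi T g : T \in unitmx ->
  Vfun h F1 F2 (compT psi T) (dual_comp g T) =
  (`|\det T|^-1%:E * Vfun h F1 F2 psi g)%E.
Proof.
move=> Tu; rewrite /Vfun Xset_compT// -(integral_Rn_mulmx _ _ Tu).
apply: (congr1 (integral_Rn _)); apply/funext => x.
rewrite /dual_comp /= grad_compT// mulmxA -trmx_mul mulmxV// trmx1 mul1mx.
by rewrite [dotv (T *m x) _]dotv_mulmxl.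
Qed.

Lemma normalize_compT psi T g : `|\det T| = 1 ->
  normalize (compT psi T) (dual_comp g T) = dual_comp (normalize psi g) T.
Proof.
move=> detT; apply/funext => y.
by rewrite /normalize Iint_compT ?normr_det1_unitmx// detT mul1e.
Qed.

Lemma Vfun_image_compT (G : ('cV[R]_n -> \bar R) -> set ('cV[R]_n -> R))
    h F1 F2 psi T :
    (forall psi' S g, S \in unitmx ->
      G psi' g -> G (compT psi' S) (dual_comp g S)) ->
    `|\det T| = 1 ->
  [set Vfun h F1 F2 (compT psi T) (normalize (compT psi T) g)
  | g in G (compT psi T)] =
  [set Vfun h F1 F2 psi (normalize psi g) | g in G psi].
Proof.
move=> Gcomp detT.
have sub_image psi' S : `|\det S| = 1 ->
    [set Vfun h F1 F2 psi' (normalize psi' g) | g in G psi'] `<=`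
    [set Vfun h F1 F2 (compT psi' S) (normalize (compT psi' S) g)
    | g in G (compT psi' S)].
  move=> detS _ [g Gg <-]; have Su := normr_det1_unitmx detS.
  exists (dual_comp g S); first exact: Gcomp.
  rewrite (normalize_compT _ _ detS) (Vfun_compT _ _ _ _ _ Su).
  by rewrite detS invr1 mul1e.
apply/seteqP; split; last exact: sub_image.
have := sub_image (compT psi T) (invmx T).
by rewrite compT_invmx ?normr_det1_unitmx// det_inv normfV detT invr1; apply.
Qed.

Lemma as_orlicz_inf_compT h F1 F2 psi T : `|\det T| = 1 ->
  as_orlicz_inf h F1 F2 (compT psi T) = as_orlicz_inf h F1 F2 psi.
Proof.
move=> detT; apply: (congr1 (@ereal_inf R)).
exact: (Vfun_image_compT _ _ _ _ Fplus_compT detT).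
Qed.

Lemma as_orlicz_sup_compT h F1 F2 psi T : `|\det T| = 1 ->
  as_orlicz_sup h F1 F2 (compT psi T) = as_orlicz_sup h F1 F2 psi.
Proof.
move=> detT; apply: (congr1 (@ereal_sup R)).
exact: (Vfun_image_compT _ _ _ _ Fplus_compT detT).
Qed.

Lemma G_orlicz_inf_compT h F1 F2 psi T : `|\det T| = 1 ->
  G_orlicz_inf h F1 F2 (compT psi T) = G_orlicz_inf h F1 F2 psi.
Proof.
move=> detT; apply: (congr1 (@ereal_inf R)).
exact: (Vfun_image_compT _ _ _ _ Lplus_compT detT).
Qed.

Lemma G_orlicz_sup_compT h F1 F2 psi T : `|\det T| = 1 ->
  G_orlicz_sup h F1 F2 (compT psi T) = G_orlicz_sup h F1 F2 psi.
Proof.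
move=> detT; apply: (congr1 (@ereal_sup R)).
exact: (Vfun_image_compT _ _ _ _ Lplus_compT detT).
Qed.

End orlicz.

Theorem theorem2p2 (R : realType) (n : nat) (psi : 'cV[R]_n -> \bar R)
    (F1 F2 h : R -> R) (T : 'M[R]_n) :
  class_C psi ->
  measurable_fun [set: R] F1 -> measurable_fun [set: R] F2 ->
  (forall t, 0 < F1 t) -> (forall t, 0 < F2 t) ->
  pos_continuous h ->
  (\det T = 1 \/ \det T = -1) ->
  [/\ PhiClass h ->
        as_orlicz_inf h F1 F2 (compT psi T) = as_orlicz_inf h F1 F2 psi /\
        G_orlicz_inf h F1 F2 (compT psi T) = G_orlicz_inf h F1 F2 psi,
      PsiClass h ->
        as_orlicz_sup h F1 F2 (compT psi T) = as_orlicz_sup h F1 F2 psi /\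
        G_orlicz_sup h F1 F2 (compT psi T) = G_orlicz_sup h F1 F2 psi,
      PhiClass h ->
        as_orlicz_inf h (@expneg R) (@expneg R) (compT psi T)
          = as_orlicz_inf h (@expneg R) (@expneg R) psi /\
        G_orlicz_inf h (@expneg R) (@expneg R) (compT psi T)
          = G_orlicz_inf h (@expneg R) (@expneg R) psi &
      PsiClass h ->
        as_orlicz_sup h (@expneg R) (@expneg R) (compT psi T)
          = as_orlicz_sup h (@expneg R) (@expneg R) psi /\
        G_orlicz_sup h (@expneg R) (@expneg R) (compT psi T)
          = G_orlicz_sup h (@expneg R) (@expneg R) psi].
Proof.
move=> _ _ _ _ _ _ detT.
have {}detT : `|\det T| = 1 by case: detT => ->; rewrite ?normrN1 ?normr1.
by split=> _; split; rewrite ?as_orlicz_inf_compT ?as_orlicz_sup_compT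
  ?G_orlicz_inf_compT ?G_orlicz_sup_compT.
Qed.
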